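(* Let $\phi\ge1$, $N\ge1$, $M\ge 1$ and $d\ge 1$ be integers and $\omega>0$. Let $\dot{\mathbf x}=f(\mathbf x,t)$, with $\mathbf x(t)\in\mathbb R^d$, be a system with polynomial-type nonlinearity of degree of nonlinearity $\phi$. If the number of collocations $M$, the truncation order $N$ and the degree of nonlinearity $\phi$ satisfy $M>(\phi+1)N$, then the reconstruction harmonic balance (RHB) method and the harmonic balance (HB) method are equivalent: under the substitution $\tilde{\mathbf x}=\mathbf E\hat{\mathbf x}$, the RHB algebraic system $$\omega\mathbf A\mathbf E^+\tilde{\mathbf x}=\mathbf E^+\tilde f(\tilde{\mathbf x})$$ is identical to the HB algebraic system $$\omega\mathbf A\hat{\mathbf x}=\hat f(\hat{\mathbf x}).$$ That is, for every $\hat{\mathbf x}\in\mathbb R^{(2N+1)\times d}$ one has $\mathbf E^+\mathbf E\hat{\mathbf x}=\hat{\mathbf x}$ and $$\mathbf E^+\tilde f(\mathbf E\hat{\mathbf x})=\hat f(\hat{\mathbf x}).$$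
   Context: Truncated Fourier ansatz: for $\hat{\mathbf x}=[\mathbf x_0\ \mathbf x_1\ \cdots\ \mathbf x_{2N}]^{\mathrm T}\in\mathbb R^{(2N+1)\times d}$ (rows $\mathbf x_k\in\mathbb R^d$), put $$\mathbf x(t)=\mathbf x_0+\sum_{n=1}^N\big[\mathbf x_{2n-1}\cos(n\omega t)+\mathbf x_{2n}\sin(n\omega t)\big].$$ Polynomial-type nonlinearity of degree $\phi$: for every $\hat{\mathbf x}$, the function obtained by substituting this $\mathbf x(t)$ into $f$ is a trigonometric polynomial of order at most $\phi N$, $$f(\mathbf x(t),t)=\mathbf h_0+\sum_{n=1}^{\phi N}\big[\mathbf h_{2n-1}\cos(n\omega t)+\mathbf h_{2n}\sin(n\omega t)\big],$$ with coefficients $\mathbf h_k=\mathbf h_k(\hat{\mathbf x})\in\mathbb R^d$ (for example, $f$ a polynomial in $\mathbf x$ of degree at most $\phi$). HB side: $\hat f(\hat{\mathbf x})=[\mathbf h_0\ \mathbf h_1\ \cdots\ \mathbf h_{2N}]^{\mathrm T}$ is the array of Fourier coefficients of $f(\mathbf x(t),t)$ retained up to order $N$. The matrix $\mathbf A$ is the $(2N+1)\times(2N+1)$ block diagonal matrix $\mathbf A=\mathrm{diag}(0,\mathbf J_1,\dots,\mathbf J_N)$ with $\mathbf J_n=n\begin{bmatrix}0&1\\-1&0\end{bmatrix}$, so that $\omega\mathbf A\hat{\mathbf x}$ is the array of Fourier coefficients of $\dot{\mathbf x}(t)$. The HB algebraic system is $\omega\mathbf A\hat{\mathbf x}=\hat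 f(\hat{\mathbf x})$. RHB side: let $t_1,\dots,t_M$ be $M$ equally spaced time nodes over one period, $t_i=t_1+\frac{2\pi(i-1)}{M\omega}$. The collocation matrix $\mathbf E$ is the $M\times(2N+1)$ matrix whose $i$-th row is $$[\,1\ \ \cos(\omega t_i)\ \ \sin(\omega t_i)\ \cdots\ \cos(N\omega t_i)\ \ \sin(N\omega t_i)\,],$$ so $\tilde{\mathbf x}:=[\mathbf x(t_1)\ \cdots\ \mathbf x(t_M)]^{\mathrm T}=\mathbf E\hat{\mathbf x}$. The matrix $\mathbf E^+$ is the Moore–Penrose inverse of $\mathbf E$, which is the $(2N+1)\times M$ matrix whose $i$-th column is $$\tfrac{2}{M}\big[\tfrac12\ \ \cos(\omega t_i)\ \ \sin(\omega t_i)\ \cdots\ \cos(N\omega t_i)\ \ \sin(N\omega t_i)\big]^{\mathrm T}.$$ The array $\tilde f(\tilde{\mathbf x})=[f(\mathbf x(t_1),t_1)\ \cdots\ f(\mathbf x(t_M),t_M)]^{\mathrm T}$ collects the values of $f$ at the collocation nodes. The RHB algebraic system is $\omega\mathbf A\mathbf E^+\tilde{\mathbf x}=\mathbf E^+\tilde f(\tilde{\mathbf x})$ with $\tilde{\mathbf x}=\mathbf E\hat{\mathbf x}$. *)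

(* Defs.v *)
From HB Require Import structures.
From mathcomp Require Import all_boot all_order all_algebra.
From mathcomp Require Import all_classical all_reals all_analysis.

Set Implicit Arguments.
Unset Strict Implicit.
Unset Printing Implicit Defensive.

Import Order.TTheory GRing.Theory Num.Theory.

Local Open Scope ring_scope.

(* Vectors of R^d are row vectors; the rows of every Fourier array follow the
   order 1, cos(wt), sin(wt), ..., cos(Nwt), sin(Nwt). *)

Definition trig_poly (R : realType) (d : nat) (omega : R) (m : nat)
    (c : nat -> 'rV[R]_d) (t : R) : 'rV[R]_d :=
  c 0%N + \sum_(1 <= n < m.+1)
    (cos (n%:R * omega * t) *: c (n.*2.-1) + sin (n%:R * omega * t) *: c n.*2).

(* The row indices k used here satisfy k <= 2N, so inord k is the index k. *)
Definition ansatz (R : realType) (d N : nat) (omega : R)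
    (xhat : 'M[R]_(N.*2.+1, d)) (t : R) : 'rV[R]_d :=
  trig_poly omega N (fun k => row (inord k) xhat) t.

(* h xhat k is the k-th coefficient of the expansion of f(x(t), t); only its
   values at k <= 2 phi N are constrained. *)
Definition polynomial_type (R : realType) (d N phi : nat) (omega : R)
    (f : 'rV[R]_d -> R -> 'rV[R]_d)
    (h : 'M[R]_(N.*2.+1, d) -> nat -> 'rV[R]_d) : Prop :=
  forall (xhat : 'M[R]_(N.*2.+1, d)) (t : R),
    f (ansatz omega xhat t) t = trig_poly omega (phi * N) (h xhat) t.

Definition hb_coeffs (R : realType) (d N : nat)
    (h : 'M[R]_(N.*2.+1, d) -> nat -> 'rV[R]_d)
    (xhat : 'M[R]_(N.*2.+1, d)) : 'M[R]_(N.*2.+1, d) :=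
  \matrix_(k < N.*2.+1) h xhat k.

(* diag(0, J_1, ..., J_N) entrywise: J_n occupies the indices 2n-1 and 2n,
   and uphalf (2n-1) = n. *)
Definition diff_mx (R : realType) (N : nat) : 'M[R]_(N.*2.+1) :=
  \matrix_(i < N.*2.+1, j < N.*2.+1)
    if odd i && (j == i.+1 :> nat) then (uphalf i)%:R
    else if odd j && (i == j.+1 :> nat) then - (uphalf j)%:R
    else 0.

(* The node t_{i+1}, since i : 'I_M is numbered from 0. *)
Definition node (R : realType) (M : nat) (omega t1 : R) (i : 'I_M) : R :=
  t1 + 2 * pi * i%:R / (M%:R * omega).

(* uphalf (2n-1) = uphalf (2n) = n is the harmonic of the k-th function. *)
Definition trig_basis (R : realType) (omega : R) (k : nat) (t : R) : R :=
  if k == 0%N then 1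
  else if odd k then cos ((uphalf k)%:R * omega * t)
  else sin ((uphalf k)%:R * omega * t).

Definition colloc_mx (R : realType) (M N : nat) (omega t1 : R) :
    'M[R]_(M, N.*2.+1) :=
  \matrix_(i < M, k < N.*2.+1) trig_basis omega k (node omega t1 i).

Definition colloc_pinv (R : realType) (M N : nat) (omega t1 : R) :
    'M[R]_(N.*2.+1, M) :=
  \matrix_(k < N.*2.+1, i < M)
    (2 / M%:R * (if k == 0%N :> nat then 2^-1
                 else trig_basis omega k (node omega t1 i))).

(* The four Penrose conditions; they determine P uniquely. *)
Definition moore_penrose (R : realType) (m n : nat)
    (E : 'M[R]_(m, n)) (P : 'M[R]_(n, m)) : Prop :=
  [/\ E *m P *m E = E, P *m E *m P = P,
      (E *m P)^T = E *m P & (P *m E)^T = P *m E].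

Definition node_values (R : realType) (d M : nat) (omega t1 : R)
    (f : 'rV[R]_d -> R -> 'rV[R]_d) (xtilde : 'M[R]_(M, d)) : 'M[R]_(M, d) :=
  \matrix_(i < M) f (row i xtilde) (node omega t1 i).

Definition HB_system (R : realType) (d N : nat) (omega : R)
    (fhat : 'M[R]_(N.*2.+1, d) -> 'M[R]_(N.*2.+1, d))
    (xhat : 'M[R]_(N.*2.+1, d)) : Prop :=
  omega *: (diff_mx R N *m xhat) = fhat xhat.

Definition RHB_system (R : realType) (d M N : nat) (omega t1 : R)
    (f : 'rV[R]_d -> R -> 'rV[R]_d) (xtilde : 'M[R]_(M, d)) : Prop :=
  let Ep := colloc_pinv M N omega t1 in
  omega *: (diff_mx R N *m Ep *m xtilde) = Ep *m node_values omega t1 f xtilde.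

Lemma colloc_mxE (R : realType) (d M N : nat) (omega t1 : R)
    (xhat : 'M[R]_(N.*2.+1, d)) :
  colloc_mx M N omega t1 *m xhat =
    \matrix_(i < M) ansatz omega xhat (node omega t1 i).
Proof.
apply/row_matrixP => i; rewrite rowK row_mul mulmx_sum_row /ansatz /trig_poly.
set t := node _ _ _.
pose F k := trig_basis omega k t *: row (inord k : 'I_(N.*2.+1)) xhat.
rewrite (eq_bigr (fun k : 'I_(N.*2.+1) => F k)); last first.
  by move=> k _; rewrite /F !mxE inord_val.
have sumF m : \sum_(k < m.*2.+1) F k =
    F 0%N + \sum_(1 <= n < m.+1) (F n.*2.-1 + F n.*2).
  elim: m => [|m IH]; first by rewrite big_ord1 big_geq ?addr0.
  have dS : m.+1.*2 = m.*2.+2 by rewrite doubleS.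
  by rewrite big_nat_recr //= dS 2!big_ord_recr IH /= !addrA.
rewrite sumF {1}/F /trig_basis /= scale1r; congr (_ + _).
apply: eq_big_nat => -[//|n] _; rewrite /F /trig_basis.
have -> : n.+1.*2.-1 = n.*2.+1 by rewrite doubleS.
by rewrite /= odd_double /= doubleK uphalf_double.
Qed.

(* Main.v *)
(** The matrix of [colloc_pinv] times a collocation matrix of order [K] is a
    matrix of discrete inner products of trigonometric functions at [M]
    equally spaced nodes. Such an inner product splits into sums of [cos] at
    the frequencies [m - n] and [m + n], and a sum over the nodes at an integer
    frequency strictly between [0] and [M] vanishes. As the frequencies are at
    most [N + K], the discrete orthogonality is exact as soon as [N + K < M].
    The case [K = N] gives [E^+ E = 1], and the case [K = phi * N] says that
    collocation recovers the first coefficients of [f (x(t), t)] without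
    aliasing. *)

Require Import Defs.
From mathcomp Require Import all_boot all_order all_algebra.
From mathcomp Require Import all_classical all_reals all_analysis.
From mathcomp Require Import ring zify.

Import Order.TTheory GRing.Theory Num.Theory.

Local Open Scope ring_scope.

(** The sum telescopes, because [2 * sin b * cos c = sin (c + b) - sin (c - b)] and consecutive
    angles differ by [2 * b]. *)
Lemma sum_cos_arith {R : realType} (a b : R) (m : nat) :
  2 * sin b * \sum_(i < m) cos (a + 2 * b * i%:R) =
    sin (a + 2 * b * m%:R - b) - sin (a - b).
Proof.
elim: m => [|m IH]; first by rewrite big_ord0 !mulr0 addr0 subrr.
rewrite big_ord_recr /= mulrDr IH.
set c := a + 2 * b * m%:R.
have -> : a + 2 * b * m.+1%:R - b = c + b by rewrite -natr1 /c; ring.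
by rewrite sinB (sinD c b); ring.
Qed.

Lemma sin_periodn {R : realType} (a : R) (n : nat) :
  sin (a + 2 * pi * n%:R) = sin a.
Proof.
elim: n => [|n IH]; first by rewrite mulr0 addr0.
have -> : a + 2 * pi * n.+1%:R = (a + 2 * pi * n%:R) + pi *+ 2.
  by rewrite -natr1 -mulr_natl; ring.
by rewrite sinD2pi.
Qed.

(** Consecutive nodes advance the angle by [2 * b] with [b = pi * n / M]. After [M] steps the angle
    has grown by [2 * pi * n], so the two ends of the telescoped sum cancel; [0 < n < M] puts [b]
    strictly between [0] and [pi], so [sin b] can be divided out. *)
Lemma sum_cos_node {R : realType} (M n : nat) (omega t1 a : R) :
  0 < omega -> (0 < n < M)%N ->
  \sum_(i < M) cos (n%:R * omega * node omega t1 i + a) = 0.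
Proof.
move=> omega_gt0 /andP[n_gt0 n_lt].
have M_gt0 : 0 < M%:R :> R by rewrite ltr0n (ltn_trans n_gt0).
set b : R := pi * n%:R / M%:R.
have sb : 2 * sin b != 0.
  rewrite mulf_neq0 ?pnatr_eq0 // gt_eqF // sin_gt0_pi //.
  have n_gt0' : 0 < n%:R :> R by rewrite ltr0n.
  rewrite /b divr_gt0 ?mulr_gt0 ?pi_gt0 //=.
  by rewrite ltr_pdivrMr // ltr_pM2l ?pi_gt0 // ltr_nat.
rewrite (eq_bigr (fun i : 'I_M =>
    cos (n%:R * omega * t1 + a + 2 * b * i%:R))); last first.
  move=> i _; congr cos; rewrite /node /b; field.
  by rewrite !gt_eqF.
apply: (mulfI sb); rewrite sum_cos_arith mulr0.
set c := n%:R * omega * t1 + a.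
have -> : c + 2 * b * M%:R - b = (c - b) + 2 * pi * n%:R.
  by rewrite /b; field; rewrite gt_eqF.
by rewrite sin_periodn subrr.
Qed.

Lemma cosM {R : realType} (u v : R) :
  cos u * cos v = 2^-1 * (cos (v - u) + cos (v + u)).
Proof. by rewrite cosB cosD; field. Qed.

(** The free phases [p] and [q] let one computation cover the cos-cos, cos-sin and sin-sin
    products. *)
Lemma sum_cos_cos_node {R : realType} (M n m : nat) (omega t1 p q : R) :
  0 < omega -> (n <= m)%N -> (0 < m)%N -> (n + m < M)%N ->
  \sum_(i < M) cos (n%:R * omega * node omega t1 i + p) *
               cos (m%:R * omega * node omega t1 i + q) =
    if n == m then M%:R / 2 * cos (q - p) else 0.
Proof.
move=> omega_gt0 n_le m_gt0 nm_lt.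
rewrite (eq_bigr (fun i : 'I_M =>
   2^-1 * (cos ((m - n)%:R * omega * node omega t1 i + (q - p)) +
           cos ((m + n)%:R * omega * node omega t1 i + (q + p))))); last first.
  move=> i _; rewrite cosM natrB // natrD.
  by congr (_ * (cos _ + cos _)); ring.
rewrite -mulr_sumr big_split /= [X in _ + X]sum_cos_node //; last by lia.
rewrite addr0; case: eqP => [->|nm]; last by rewrite sum_cos_node ?mulr0 //; lia.
under eq_bigr do rewrite subnn !mul0r add0r.
by rewrite sumr_const card_ord -mulr_natl; ring.
Qed.

(** The shift that turns a cosine into the [k]-th basis function: sine is cosine delayed by a
    quarter period. *)
Definition phase (R : realType) (k : nat) : R :=
  if (k == 0%N) || odd k then 0 else - (pi / 2).

Lemma trig_basisE {R : realType} (omega t : R) (k : nat) :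
  trig_basis omega k t = cos ((uphalf k)%:R * omega * t + phase R k).
Proof.
rewrite /trig_basis /phase; case: eqP => [->|_] /=.
  by rewrite !mul0r addr0 cos0.
case: odd; first by rewrite addr0.
by rewrite cosB cos_pihalf sin_pihalf mulr0 mulr1 add0r.
Qed.

Lemma trig_basis_orthogonal {R : realType} (M k l : nat) (omega t1 : R) :
  0 < omega -> (uphalf k + uphalf l < M)%N ->
  \sum_(i < M) trig_basis omega k (node omega t1 i) *
               trig_basis omega l (node omega t1 i) =
    if k == l then (if k == 0%N then M%:R else M%:R / 2) else 0.
Proof.
move=> omega_gt0; wlog kl : k l / (k <= l)%N => [H|] ltM.
  case/orP: (leq_total k l) => kl; first exact: H.
  under eq_bigr do rewrite mulrC.
  by rewrite H // 1?addnC // (eq_sym k l); case: eqP => // ->.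
have [l0|l_gt0] := posnP l.
  have -> : k = 0%N by lia.
  rewrite l0 /trig_basis /= (eq_bigr (fun=> 1)) => [|i _]; last by rewrite mulr1.
  by rewrite sumr_const card_ord.
under eq_bigr do rewrite !trig_basisE.
rewrite sum_cos_cos_node //; [|lia..].
case: (k =P l) => [ekl|kNl].
  by rewrite -ekl eqxx subrr cos0 mulr1; case: eqP => //; lia.
(* Distinct indices [k < l] with the same harmonic [n] are [2n-1] and [2n], a cosine and a sine;
   their phases differ by [pi / 2], so the remaining cosine factor vanishes. *)
case: eqP => // ukl.
have [kodd leven] : odd k /\ ~~ odd l by lia.
rewrite /phase kodd (negbTE leven) orbT gtn_eqF //=.
by rewrite subr0 cosN cos_pihalf mulr0.
Qed.

Lemma colloc_pinv_mul_colloc {R : realType} (M N K : nat) (omega t1 : R) :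
  0 < omega -> (N + K < M)%N ->
  colloc_pinv M N omega t1 *m colloc_mx M K omega t1 =
    \matrix_(k, l) (k == l :> nat)%:R.
Proof.
move=> omega_gt0 ltM; apply/matrixP => k l; rewrite !mxE.
have M_neq0 : M%:R != 0 :> R by rewrite pnatr_eq0; lia.
have ltkl : (uphalf k + uphalf l < M)%N by have := ltn_ord k; have := ltn_ord l; lia.
(* [c] is the inverse of the squared discrete norm of the [k]-th basis function: [1 / M] for the
   constant, [2 / M] otherwise. *)
pose c : R := 2 / M%:R * (if k == 0%N :> nat then 2^-1 else 1).
rewrite (eq_bigr (fun i => c * (trig_basis omega k (node omega t1 i) *
                                trig_basis omega l (node omega t1 i)))).
  rewrite -mulr_sumr trig_basis_orthogonal // /c.
  by case: eqP => _; case: eqP => _; rewrite ?mulr0 //=; field.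
move=> i _; rewrite !mxE /c /trig_basis.
by case: (k == 0%N :> nat); ring.
Qed.

Lemma colloc_pinvK {R : realType} (M N : nat) (omega t1 : R) :
  0 < omega -> (N + N < M)%N ->
  colloc_pinv M N omega t1 *m colloc_mx M N omega t1 = 1%:M.
Proof.
move=> omega_gt0 ltM; rewrite colloc_pinv_mul_colloc //.
by apply/matrixP => k l; rewrite !mxE.
Qed.

(** [colloc_pinv] is a diagonal matrix [D] times the transpose of [E = colloc_mx], and [E D E^T] is
    symmetric. *)
Lemma colloc_mul_pinv_sym {R : realType} (M N : nat) (omega t1 : R) :
  (colloc_mx M N omega t1 *m colloc_pinv M N omega t1)^T =
    colloc_mx M N omega t1 *m colloc_pinv M N omega t1.
Proof.
apply/matrixP => i j; rewrite !mxE; apply: eq_bigr => k _; rewrite !mxE.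
by rewrite /trig_basis; case: (k == 0%N :> nat); ring.
Qed.

Lemma moore_penrose_colloc {R : realType} (M N : nat) (omega t1 : R) :
  0 < omega -> (N + N < M)%N ->
  moore_penrose (colloc_mx M N omega t1) (colloc_pinv M N omega t1).
Proof.
move=> omega_gt0 ltM; split; last 2 first.
- exact: colloc_mul_pinv_sym.
- by rewrite colloc_pinvK // trmx1.
- by rewrite -mulmxA colloc_pinvK // mulmx1.
- by rewrite colloc_pinvK // mul1mx.
Qed.

(** The expansion of [f (x(t), t)] is itself an ansatz of order [phi * N], so [colloc_mxE] applies
    at that order too. *)
Lemma node_values_colloc {R : realType} (phi N M d : nat) (omega t1 : R)
    (f : 'rV[R]_d -> R -> 'rV[R]_d)
    (h : 'M[R]_(N.*2.+1, d) -> nat -> 'rV[R]_d) (xhat : 'M[R]_(N.*2.+1, d)) :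
  polynomial_type phi omega f h ->
  node_values omega t1 f (colloc_mx M N omega t1 *m xhat) =
    colloc_mx M (phi * N) omega t1 *m
      \matrix_(k < (phi * N).*2.+1) h xhat k.
Proof.
move=> f_poly; rewrite !colloc_mxE; apply/row_matrixP => i.
rewrite !rowK f_poly /ansatz /trig_poly rowK inordK //; congr (_ + _).
apply: eq_big_nat => n n_bnd.
by rewrite !rowK !inordK //; lia.
Qed.

Theorem theorem2 (R : realType) (phi N M d : nat) (omega t1 : R)
    (f : 'rV[R]_d -> R -> 'rV[R]_d)
    (h : 'M[R]_(N.*2.+1, d) -> nat -> 'rV[R]_d)
    (phi_ge1 : (1 <= phi)%N) (N_ge1 : (1 <= N)%N)
    (M_ge1 : (1 <= M)%N) (d_ge1 : (1 <= d)%N)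
    (omega_gt0 : 0 < omega)
    (f_poly : polynomial_type phi omega f h)
    (M_gt : ((phi + 1) * N < M)%N) :
  let E := colloc_mx M N omega t1 in
  let Ep := colloc_pinv M N omega t1 in
  moore_penrose E Ep /\
  forall xhat : 'M[R]_(N.*2.+1, d),
    [/\ Ep *m E *m xhat = xhat,
        Ep *m node_values omega t1 f (E *m xhat) = hb_coeffs h xhat &
        RHB_system N omega t1 f (E *m xhat) <->
        HB_system omega (hb_coeffs h) xhat].
Proof.
move=> E Ep.
have le_N : (N <= phi * N)%N by rewrite leq_pmull.
have lt_phi : (N + phi * N < M)%N by move: M_gt; rewrite mulnDl mul1n addnC.
have lt_NN : (N + N < M)%N by lia.
split=> [|xhat]; first exact: moore_penrose_colloc.
have EpE : Ep *m E = 1%:M by exact: colloc_pinvK.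
have Epf : Ep *m node_values omega t1 f (E *m xhat) = hb_coeffs h xhat.
  rewrite (node_values_colloc _ _ _ _ _ _ _ _ _ f_poly) mulmxA.
  rewrite colloc_pinv_mul_colloc //.
  apply/matrixP => k j; rewrite !mxE.
  have ltk : (k < (phi * N).*2.+1)%N by have := ltn_ord k; lia.
  (* The rectangular identity keeps the coefficients of index at most [2N] and drops the higher
     ones, which is the HB truncation. *)
  rewrite (bigD1 (Ordinal ltk)) //= !mxE eqxx mul1r big1 ?addr0 // => l lNk.
  by rewrite !mxE eq_sym (negbTE (lNk : l != k :> nat)) mul0r.
split=> //; first by rewrite EpE mul1mx.
rewrite /RHB_system /HB_system -/Ep Epf -mulmxA (mulmxA Ep) EpE mul1mx.
by [].
Qed.
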